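(* Suppose that there exists an integer $\delta \geqslant 9$ such that $\theta(n) \leqslant \left(2^{2^{n-5}}-1\right)^{2^{n-5}}+1$ for every integer $n \geqslant \delta$. Then there exists an algorithm which takes as input a Diophantine equation $D(x_1,\ldots,x_p)=0$ (with $D \in \mathbb{Z}[x_1,\ldots,x_p]$) and returns ''Yes'' or ''No'', such that whenever the equation has only finitely many solutions in positive integers, the output correctly states whether the equation has a solution in positive integers.
   Context: For a positive integer $n$, let $E_n=\{x_i \cdot x_j=x_k,\ x_i+1=x_k:\ i,j,k \in \{1,\ldots,n\}\}$, a set of equations in the variables $x_1,\ldots,x_n$. Let $\theta(n)$ denote the smallest positive integer $b$ such that for each system $S \subseteq E_n$ which has a solution in positive integers $x_1,\ldots,x_n$ and which has only finitely many solutions in positive integers $x_1,\ldots,x_n$, there exists a solution of $S$ in $([1,b] \cap \mathbb{N})^n$. *)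

(* Defs.v *)
From mathcomp Require Import all_boot all_order all_algebra.
From mathcomp Require Import mpoly.
From mathcomp Require Import boolp classical_sets cardinality.

Set Implicit Arguments.
Unset Strict Implicit.
Unset Printing Implicit Defensive.

Local Open Scope classical_set_scope.

(* E_n: [inl (i, j, k)] is the equation x_i * x_j = x_k, and [inr (i, k)] is
   the equation x_i + 1 = x_k. *)
Definition E (n : nat) : finType := ('I_n * 'I_n * 'I_n + 'I_n * 'I_n)%type.

Definition satisfies n (x : {ffun 'I_n -> nat}) (e : E n) : Prop :=
  match e with
  | inl (i, j, k) => x i * x j = x k
  | inr (i, k) => x i + 1 = x k
  end.

Definition solutions n (S : {set E n}) : set {ffun 'I_n -> nat} :=
  [set x : {ffun 'I_n -> nat} |
    (forall i, 0 < x i) /\ (forall e, e \in S -> satisfies x e)].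

Definition bounds_systems n (b : nat) : Prop :=
  forall S : {set E n},
    solutions S !=set0 -> finite_set (solutions S) ->
    exists x, solutions S x /\ (forall i, x i <= b).

Lemma ex_bounds_systems n : exists b, `[< 0 < b /\ bounds_systems n b >].
Proof.
have ex_b (S : {set E n}) : exists b, solutions S !=set0 ->
    exists x, solutions S x /\ (forall i, x i <= b).
  have [[x Sx]|nS] := pselect (solutions S !=set0); last by exists 0.
  exists (\max_i x i) => _; exists x; split=> // i.
  exact: (leq_bigmax i).
have [f fP] := boolp.choice ex_b.
exists (\max_(S : {set E n}) f S).+1; apply/asboolP; split=> // S S0 _.
have [x [Sx xf]] := fP S S0; exists x; split=> // i.
by rewrite (leq_trans (xf i)) // leqW // leq_bigmax.
Qed.

Definition theta (n : nat) : nat := ex_minn (ex_bounds_systems n).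

(* Programs for Kleene's k-ary partial recursive functions. *)
Inductive murec : nat -> Type :=
| MZero k : murec k
| MSucc : murec 1
| MProj k (i : 'I_k) : murec k
| MComp m k (f : murec m) (g : 'I_m -> murec k) : murec k
| MPrec k (f : murec k) (g : murec k.+2) : murec k.+1
| MMin k (f : murec k.+1) : murec k.

(* [mueval f v y]: the program f halts on the input v with output y.
   In the case [MPrec], s is the sequence of the successive values of the
   recursion; in the case [MMin], y is the least zero and the values of f
   below y are all defined and nonzero. *)
Fixpoint mueval k (f : murec k) : k.-tuple nat -> nat -> Prop :=
  match f in murec k return k.-tuple nat -> nat -> Prop with
  | MZero _ => fun _ y => y = 0
  | MSucc => fun v y => y = (thead v).+1
  | MProj _ i => fun v y => y = tnth v i
  | MComp m _ f g => fun v y =>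
      exists w : m.-tuple nat,
        (forall i, mueval (g i) v (tnth w i)) /\ mueval f w y
  | MPrec _ f g => fun v y =>
      exists s : nat -> nat,
        [/\ mueval f [tuple of behead v] (s 0),
            forall i, i < thead v ->
              mueval g [tuple of i :: s i :: behead v] (s i.+1)
          & y = s (thead v)]
  | MMin _ f => fun v y =>
      mueval f [tuple of y :: v] 0 /\
      (forall i, i < y -> exists z, mueval f [tuple of i :: v] z.+1)
  end.

Lemma mueval_inj k (f : murec k) v y z : mueval f v y -> mueval f v z -> y = z.
Proof.
elim: f v y z => {k} /=.
- by move=> k v y z -> ->.
- by move=> v y z -> ->.
- by move=> k i v y z -> ->.
- move=> m k f IHf g IHg v y z [w [gw fw]] [w' [gw' fw']].
  suff eqw : w = w' by rewrite -eqw in fw'; exact: IHf fw fw'.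
  by apply: eq_from_tnth => i; exact: IHg (gw i) (gw' i).
- move=> k f IHf g IHg v y z [s [s0 sS ->]] [t [t0 tS ->]].
  suff eqst i : i <= thead v -> s i = t i by exact: eqst.
  elim: i => [_|i IHi lt_iv]; first exact: IHf s0 t0.
  have := tS i lt_iv; rewrite -(IHi (ltnW lt_iv)); exact: IHg (sS i lt_iv).
- move=> k f IHf v y z [fy ltfy] [fz ltfz].
  have [lt_yz|lt_zy|//] := ltngtP y z.
    by have [u /(IHf _ _ _ fy)] := ltfz y lt_yz.
  by have [u /(IHf _ _ _ fz)] := ltfy z lt_zy.
Qed.

Definition dioph_solutions p (D : {mpoly int[p]}) : set {ffun 'I_p -> nat} :=
  [set x : {ffun 'I_p -> nat} |
    (forall i, 0 < x i) /\ D.@[fun i => Posz (x i)]%R = 0%R].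

(* Cantor's pairing function. *)
Definition code_pair (a b : nat) : nat := ((a + b) * (a + b).+1)./2 + b.

Fixpoint code_seq (s : seq nat) : nat :=
  if s is a :: s' then (code_pair a (code_seq s')).+1 else 0.

Definition code_int (z : int) : nat :=
  match z with Posz n => n.*2 | Negz n => n.*2.+1 end.

(* Gödel number of the pair (p, D): D is given as the list of its terms
   c * x^m with c != 0, as pairs of the coefficient c and the list of the p
   exponents of m, sorted by the degree lexicographic order on monomials. *)
Definition code_dioph p (D : {mpoly int[p]}) : nat :=
  code_pair p
    (code_seq [seq code_pair (code_int D@_m) (code_seq m)
              | m : 'X_{1..p} <- sort <=%O (msupp D)]).

(* Main.v *)
(** Let c be the code of the equation D = 0. Writing D = D+ - D- with
    nonnegative coefficients, D+ + 1 = D- + 1 is turned into a system in E_n,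
    with n = 22 c + 3 + delta, whose positive solutions are in bijection with
    those of D = 0: every subterm gets a variable, and x + y = z is expressed
    by (x z + 1) (y z + 1) = z^2 (x y + 1) + 1. Thus, if D = 0 has a solution
    and has only finitely many, it has one whose coordinates are bounded by
    theta n, hence by an explicit primitive recursive function of c. The
    algorithm tries all points up to this bound; its answer "Yes" is always
    correct. *)

Require Import Defs.
From mathcomp Require Import all_boot all_order all_algebra.
From mathcomp Require Import mpoly.
From mathcomp Require Import boolp classical_sets cardinality.
From mathcomp Require Import zify.

(** * Total recursive functions of several arguments *)

Definition computable k (F : seq nat -> nat) : Prop :=
  exists P : murec k, forall v : k.-tuple nat, mueval P v (F v).

Lemma computable_ext k (F G : seq nat -> nat) :
  (forall v : k.-tuple nat, F v = G v) -> computable k F -> computable k G.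
Proof. by move=> FG [P PF]; exists P => v; rewrite -FG. Qed.

Lemma computable_nth k i : i < k -> computable k (fun v => nth 0 v i).
Proof.
move=> lt_ik; exists (MProj (Ordinal lt_ik)) => v /=.
by rewrite (tnth_nth 0).
Qed.

Lemma computable_succ : computable 1 (fun v => (nth 0 v 0).+1).
Proof. by exists MSucc => v /=; rewrite /thead (tnth_nth 0). Qed.

Lemma computable_comp k (Gs : seq (seq nat -> nat)) F :
  computable (size Gs) F ->
  (forall i, i < size Gs -> computable k (nth (fun=> 0) Gs i)) ->
  computable k (fun v => F [seq G v | G <- Gs]).
Proof.
move=> [P PF] cG.
have /boolp.choice[Q QG] : forall i : 'I_(size Gs),
    exists Q : murec k, forall v : k.-tuple nat,
      mueval Q v (nth (fun=> 0) Gs i v) by move=> i; exact: cG.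
exists (MComp P Q) => v /=.
exists (map_tuple (fun G : seq nat -> nat => G v) (in_tuple Gs)).
split=> [i|]; last exact: PF.
by rewrite tnth_map (tnth_nth (fun=> 0)); exact: QG.
Qed.

Lemma computable_app1 k f F : computable 1 (fun v => f (nth 0 v 0)) ->
  computable k F -> computable k (fun v => f (F v)).
Proof.
move=> cf cF.
by apply: (@computable_comp k [:: F] (fun v => f (nth 0 v 0))) => // -[|[]].
Qed.

Lemma computable_app2 k f F G :
  computable 2 (fun v => f (nth 0 v 0) (nth 0 v 1)) ->
  computable k F -> computable k G -> computable k (fun v => f (F v) (G v)).
Proof.
move=> cf cF cG.
by apply: (@computable_comp k [:: F; G] (fun v => f (nth 0 v 0) (nth 0 v 1)))
  => // -[|[|[]]].
Qed.

Lemma computable_const k c : computable k (fun=> c).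
Proof.
elim: c => [|c IHc]; first by exists (MZero k).
exact: computable_app1 computable_succ IHc.
Qed.

(** [iteri] hands its step the index and then the accumulator, in the order of [MPrec]; its
    successive values form the sequence that [mueval] asks for. *)
Lemma computable_prec k F G : computable k F -> computable k.+2 G ->
  computable k.+1 (fun v =>
    iteri (nth 0 v 0) (fun i a => G [:: i, a & behead v]) (F (behead v))).
Proof.
move=> [P PF] [Q QG]; exists (MPrec P Q) => v /=.
rewrite /thead (tnth_nth 0) /=.
exists (fun n => iteri n (fun i a => G [:: i, a & behead v]) (F (behead v))).
split=> [|i _|//]; first exact: (PF [tuple of behead v]).
exact: (QG [tuple of [:: i, _ & behead v]]).
Qed.

Lemma iteri_iter T n (f : T -> T) x : iteri n (fun=> f) x = iter n f x.
Proof. by elim: n => //= n ->. Qed.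

Lemma computable_addn : computable 2 (fun v => nth 0 v 0 + nth 0 v 1).
Proof.
apply: computable_ext (@computable_prec 1 _ _ (@computable_nth 1 0 isT)
  (computable_app1 _ _ _ computable_succ (@computable_nth 3 1 isT))) => v.
by rewrite /= iteri_iter nth_behead iter_succn addnC.
Qed.

Lemma computable_predn : computable 1 (fun v => (nth 0 v 0).-1).
Proof.
apply: computable_ext (@computable_prec 0 _ _ (computable_const 0 0)
  (@computable_nth 2 0 isT)) => v /=.
by case: (nth 0 v 0).
Qed.

Lemma computable_subn : computable 2 (fun v => nth 0 v 0 - nth 0 v 1).
Proof.
(* Recursion runs on the first argument, so the function computed is b - a, as a iterated
   predecessors of b. *)
apply: (@computable_app2 2 (fun a b => b - a)); last 2 first.
- exact: computable_nth.
- exact: computable_nth.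
apply: computable_ext (@computable_prec 1 _ _ (@computable_nth 1 0 isT)
  (computable_app1 _ _ _ computable_predn (@computable_nth 3 1 isT))) => v.
rewrite /= iteri_iter nth_behead.
by elim: (nth 0 v 0) => [|n IHn] /=; rewrite ?subn0 // IHn subnS.
Qed.

Lemma computable_muln : computable 2 (fun v => nth 0 v 0 * nth 0 v 1).
Proof.
apply: computable_ext (@computable_prec 1 _ _ (computable_const 1 0)
  (computable_app2 _ addn _ _ computable_addn (@computable_nth 3 1 isT)
     (@computable_nth 3 2 isT))) => v /=.
rewrite nth_behead.
by elim: (nth 0 v 0) => //= n ->; rewrite mulSn addnC.
Qed.

(** * Inverting Cantor's pairing function *)

Definition triangular n := iteri n (fun i a => a + i.+1) 0.

Arguments triangular : simpl never.

Lemma triangularE n : triangular n = (n * n.+1)./2.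
Proof. by rewrite /triangular; elim: n => //= n ->; lia. Qed.

Lemma triangularS n : triangular n.+1 = triangular n + n.+1.
Proof. by []. Qed.

Lemma triangular_mono m n : m <= n -> triangular m <= triangular n.
Proof.
move=> /subnK <-; elim: (n - m) => // k IHk.
by rewrite addSn triangularS; lia.
Qed.

(* [diag z] is the sum of the components of the pair coded by [z]. *)
Definition diag z := iteri z (fun i s => s + (1 - (triangular s.+1 - i.+1))) 0.

(** The truncated difference 1 - (t - z) is the indicator of t <= z, so the recursion for [diag]
    moves to the next diagonal exactly when the next triangular number is reached. *)
Lemma diagP z : triangular (diag z) <= z < triangular (diag z).+1.
Proof.
rewrite /diag; elim: z => [//|z] /=; set s := iteri z _ _.
rewrite triangularS => /andP[le_sz lt_zs].
have [le_s|gt_s] := leqP (triangular s + s.+1) z.+1.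
  have -> : 1 - (triangular s + s.+1 - z.+1) = 1 by lia.
  by rewrite addn1 !triangularS; lia.
have -> : 1 - (triangular s + s.+1 - z.+1) = 0 by lia.
by rewrite addn0 triangularS; lia.
Qed.

Definition unpair2 z := z - triangular (diag z).
Definition unpair1 z := diag z - unpair2 z.

(** Since b <= a + b, the code lies between the triangular numbers of a + b and a + b + 1, and by
    monotonicity only one diagonal has this property. *)
Lemma diag_code_pair a b : diag (code_pair a b) = a + b.
Proof.
have := diagP (code_pair a b); rewrite /code_pair -triangularE triangularS.
move=> /andP[le_s lt_s].
have [lt_ab|lt_ab|//] := ltngtP (diag (triangular (a + b) + b)) (a + b).
  by have := triangular_mono _ _ lt_ab; rewrite triangularS; lia.
by have := triangular_mono _ _ lt_ab; rewrite triangularS; lia.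
Qed.

Lemma unpair2K a b : unpair2 (code_pair a b) = b.
Proof. by rewrite /unpair2 diag_code_pair /code_pair -triangularE addKn. Qed.

Lemma unpair1K a b : unpair1 (code_pair a b) = a.
Proof. by rewrite /unpair1 unpair2K diag_code_pair addnK. Qed.

Lemma computable_triangular : computable 1 (fun v => triangular (nth 0 v 0)).
Proof.
apply: computable_ext (@computable_prec 0 _ _ (computable_const 0 0)
  (computable_app2 _ addn _ _ computable_addn (@computable_nth 2 1 isT)
     (computable_app1 _ _ _ computable_succ (@computable_nth 2 0 isT)))) => v.
by [].
Qed.

Lemma computable_diag : computable 1 (fun v => diag (nth 0 v 0)).
Proof.
pose succ_nth i lt_i2 :=
  computable_app1 _ _ _ computable_succ (@computable_nth 2 i lt_i2).
apply: computable_ext (@computable_prec 0 _ _ (computable_const 0 0)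
  (computable_app2 _ addn _ _ computable_addn (@computable_nth 2 1 isT)
     (computable_app2 _ subn _ _ computable_subn (computable_const 2 1)
        (computable_app2 _ subn _ _ computable_subn
          (computable_app1 _ _ _ computable_triangular (succ_nth 1 isT))
          (succ_nth 0 isT))))) => v.
by [].
Qed.

(** * A calculus of unary recursive functions, with tuples coded by pairing *)

Definition computable1 (f : nat -> nat) : Prop :=
  computable 1 (fun v => f (nth 0 v 0)).

Lemma eq_computable1 f g : f =1 g -> computable1 f -> computable1 g.
Proof. by move=> fg; apply: computable_ext => v. Qed.

Lemma computable1_id : computable1 id.
Proof. exact: computable_nth. Qed.

Lemma computable1_const c : computable1 (fun=> c).
Proof. exact: computable_const. Qed.

Lemma computable1_comp f g :
  computable1 f -> computable1 g -> computable1 (fun e => f (g e)).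
Proof. exact: computable_app1. Qed.

Lemma computable1_add f g :
  computable1 f -> computable1 g -> computable1 (fun e => f e + g e).
Proof. exact: computable_app2 computable_addn. Qed.

Lemma computable1_sub f g :
  computable1 f -> computable1 g -> computable1 (fun e => f e - g e).
Proof. exact: computable_app2 computable_subn. Qed.

Lemma computable1_mul f g :
  computable1 f -> computable1 g -> computable1 (fun e => f e * g e).
Proof. exact: computable_app2 computable_muln. Qed.

Lemma computable1_succ f : computable1 f -> computable1 (fun e => (f e).+1).
Proof. exact: computable_app1 computable_succ. Qed.

Lemma computable_pair k F G : computable k F -> computable k G ->
  computable k (fun v => code_pair (F v) (G v)).
Proof.
move=> cF cG; apply: (@computable_ext k
    (fun v => triangular (F v + G v) + G v)) => [v|].
  by rewrite triangularE.
apply: (computable_app2 _ _ _ _ computable_addn _ cG).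
apply: computable_app1 computable_triangular _.
exact: computable_app2 computable_addn cF cG.
Qed.

Lemma computable1_pair f g :
  computable1 f -> computable1 g ->
  computable1 (fun e => code_pair (f e) (g e)).
Proof. exact: computable_pair. Qed.

Lemma computable1_unpair2 f :
  computable1 f -> computable1 (fun e => unpair2 (f e)).
Proof.
move=> cf; apply: computable1_sub => //.
apply: computable_app1 computable_triangular _.
exact: computable_app1 computable_diag cf.
Qed.

Lemma computable1_unpair1 f :
  computable1 f -> computable1 (fun e => unpair1 (f e)).
Proof.
move=> cf; apply: computable1_sub; last exact: computable1_unpair2.
exact: computable_app1 computable_diag cf.
Qed.

(** The step depends on parameter, index and accumulator. Requiring its computability as a function
    of one number q that codes this triple keeps all closure rules unary. *)
Lemma computable1_iteri n g a : computable1 n -> computable1 a ->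
  computable1 (fun q =>
    g (unpair1 q) (unpair1 (unpair2 q)) (unpair2 (unpair2 q))) ->
  computable1 (fun e => iteri (n e) (g e) (a e)).
Proof.
move=> cn ca cg.
(* Primitive recursion supplies index, accumulator, parameter in this order, whereas [g] takes the
   parameter first. *)
have cg3 : computable 3 (fun v => g (nth 0 v 2) (nth 0 v 0) (nth 0 v 1)).
  have cp : computable 3 (fun v =>
      code_pair (nth 0 v 2) (code_pair (nth 0 v 0) (nth 0 v 1))).
    by do 2?apply: computable_pair; apply: computable_nth.
  apply: computable_ext (@computable_app1 3 (fun q =>
    g (unpair1 q) (unpair1 (unpair2 q)) (unpair2 (unpair2 q))) _ cg cp) => v.
  by rewrite !(unpair1K, unpair2K).
have crec := @computable_prec 1 _ _ ca cg3.
apply: (@computable_ext 1) (@computable_app2 1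
  (fun m e => iteri m (fun i b => g e i b) (a e)) _ _ _ cn
  computable1_id) => //.
by apply: computable_ext crec => v /=; rewrite nth_behead.
Qed.

Lemma computable1_exp f g :
  computable1 f -> computable1 g -> computable1 (fun e => f e ^ g e).
Proof.
move=> cf cg.
apply: (@eq_computable1 (fun e => iteri (g e) (fun=> muln (f e)) 1)) => [e|].
  by elim: (g e) => //= n ->; rewrite expnS.
apply: (computable1_iteri _ (fun e _ a => f e * a)) => //.
  exact: computable1_const.
apply: computable1_mul; last first.
  by do 2!apply: computable1_unpair2; apply: computable1_id.
by apply: computable1_comp cf _; apply: computable1_unpair1 computable1_id.
Qed.

Lemma computable1_iter n g a : computable1 n -> computable1 a ->
  computable1 (fun q => g (unpair1 q) (unpair2 (unpair2 q))) ->
  computable1 (fun e => iter (n e) (g e) (a e)).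
Proof.
move=> cn ca cg; apply: (@eq_computable1
    (fun e => iteri (n e) (fun=> g e) (a e))) => [e|]; first exact: iteri_iter.
exact: (computable1_iteri _ (fun e _ => g e)).
Qed.

Lemma computable1_odd f :
  computable1 f -> computable1 (fun e => odd (f e) : nat).
Proof.
move=> cf; apply: (computable1_comp (fun n => odd n : nat) f _ cf).
apply: (@eq_computable1 (fun e => iter e (fun a => 1 - a) 0)) => [e|].
  by elim: e => //= n ->; case: (odd n).
apply: (computable1_iter _ (fun _ a => 1 - a)).
- exact: computable1_id.
- exact: computable1_const.
- apply: computable1_sub; first exact: computable1_const.
  by do 2!apply: computable1_unpair2; apply: computable1_id.
Qed.

Lemma computable1_half f : computable1 f -> computable1 (fun e => (f e)./2).
Proof.
move=> cf; apply: (computable1_comp half f _ cf).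
apply: (@eq_computable1 (fun e => iteri e (fun i a => a + odd i) 0)) => [e|].
  by elim: e => //= n ->; lia.
apply: (computable1_iteri _ (fun _ i a => a + odd i)).
- exact: computable1_id.
- exact: computable1_const.
- apply: computable1_add.
    by do 2!apply: computable1_unpair2; apply: computable1_id.
  apply: computable1_odd; apply: computable1_unpair1.
  by apply: computable1_unpair2; apply: computable1_id.
Qed.

Lemma computable1_eq f g : computable1 f -> computable1 g ->
  computable1 (fun e => (f e == g e) : nat).
Proof.
move=> cf cg; apply: (@eq_computable1
    (fun e => 1 - ((f e - g e) + (g e - f e)))) => [e|]; first by lia.
apply: computable1_sub; first exact: computable1_const.
by apply: computable1_add; apply: computable1_sub.
Qed.

Lemma computable1_gt0 f :
  computable1 f -> computable1 (fun e => (0 < f e) : nat).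
Proof.
move=> cf; apply: (@eq_computable1 (fun e => 1 - (1 - f e))) => [e|].
  by lia.
have c1 := computable1_const 1.
by apply: computable1_sub => //; apply: computable1_sub.
Qed.

Lemma computable1_if (b : nat -> bool) f g :
  computable1 (fun e => b e : nat) -> computable1 f -> computable1 g ->
  computable1 (fun e => if b e then f e else g e).
Proof.
move=> cb cf cg; apply: (@eq_computable1
    (fun e => b e * f e + (1 - b e) * g e)) => [e|].
  by case: (b e); lia.
apply: computable1_add; apply: computable1_mul => //.
by apply: computable1_sub => //; apply: computable1_const.
Qed.

Lemma computable1_sum n f : computable1 n ->
  computable1 (fun q => f (unpair1 q) (unpair1 (unpair2 q))) ->
  computable1 (fun e => \sum_(i < n e) f e i).
Proof.
move=> cn cf; apply: (@eq_computable1
    (fun e => iteri (n e) (fun i a => a + f e i) 0)) => [e|].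
  by elim: (n e) => [|m IHm]; rewrite ?big_ord0 // big_ord_recr /= IHm.
apply: (computable1_iteri _ (fun e i a => a + f e i)) => //.
  exact: computable1_const.
apply: computable1_add => //.
by do 2!apply: computable1_unpair2; apply: computable1_id.
Qed.

(** * Sizes of codes, and folds over coded sequences *)

Lemma leq_add_code_pair a b : a + b <= code_pair a b.
Proof. by rewrite /code_pair; nia. Qed.

Lemma code_pair_leq_sqr a b : code_pair a b <= (a + b + 1) ^ 2.
Proof. by rewrite /code_pair -mulnn; nia. Qed.

Lemma leq_sum_code_seq s : \sum_(a <- s) a.+1 <= code_seq s.
Proof.
elim: s => [|a s IHs] /=; first by rewrite big_nil.
by rewrite big_cons; have := leq_add_code_pair a (code_seq s); lia.
Qed.

Lemma size_code_seq s : size s <= code_seq s.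
Proof.
apply: leq_trans (leq_sum_code_seq s).
by rewrite -sum1_size; apply: leq_sum.
Qed.

(** A state pairs the accumulator with the code of the unread suffix. The code of a nonempty
    sequence is a successor, hence the - 1. A state with empty suffix is fixed, so extra iterations
    are harmless, and the code itself can serve as the number of iterations. *)
Definition code_fold_step (g : nat -> nat -> nat) st :=
  if unpair2 st == 0 then st else
  code_pair (g (unpair1 st) (unpair1 (unpair2 st - 1)))
            (unpair2 (unpair2 st - 1)).

Definition code_fold g a c :=
  unpair1 (iter c (code_fold_step g) (code_pair a c)).

Lemma code_foldE g a s : code_fold g a (code_seq s) = foldl g a s.
Proof.
rewrite /code_fold; suff iterE n : size s <= n ->
    iter n (code_fold_step g) (code_pair a (code_seq s)) =
    code_pair (foldl g a s) 0.
  by rewrite iterE ?unpair1K // size_code_seq.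
elim: n s a => [|n IHn] [|b s] a //=; rewrite -?iterS iterSr.
  move=> _; rewrite /code_fold_step unpair2K /=.
  by rewrite -[in LHS]/(code_seq [::]) IHn.
by move=> le_sn; rewrite /code_fold_step !unpair2K /= unpair1K subn1 /=
  unpair1K unpair2K IHn.
Qed.

Lemma computable1_code_fold g a c : computable1 a -> computable1 c ->
  computable1 (fun q =>
    g (unpair1 q) (unpair1 (unpair2 q)) (unpair2 (unpair2 q))) ->
  computable1 (fun e => code_fold (g e) (a e) (c e)).
Proof.
move=> ca cc cg; apply: computable1_unpair1.
apply: (computable1_iter _ (fun e => code_fold_step (g e))) => //.
  exact: computable1_pair.
have cst : computable1 (fun q => unpair2 (unpair2 q)).
  by do 2!apply: computable1_unpair2; apply: computable1_id.
have cst2 := computable1_unpair2 _ cst.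
have cpred : computable1 (fun q => unpair2 (unpair2 (unpair2 q)) - 1).
  by apply: computable1_sub => //; apply: computable1_const.
apply: computable1_if => //.
  by apply: computable1_eq => //; apply: computable1_const.
apply: computable1_pair; last exact: computable1_unpair2.
(* The arguments of [g] are packed again into a coded triple r, to which the hypothesis on [g]
   applies. *)
apply: (@eq_computable1 (fun q => (fun r =>
    g (unpair1 r) (unpair1 (unpair2 r)) (unpair2 (unpair2 r)))
    (code_pair (unpair1 q) (code_pair (unpair1 (unpair2 (unpair2 q)))
      (unpair1 (unpair2 (unpair2 (unpair2 q)) - 1)))))) => [q|].
  by rewrite !(unpair1K, unpair2K).
apply: computable1_comp cg _; apply: computable1_pair.
  exact: computable1_unpair1 computable1_id.
by apply: computable1_pair; apply: computable1_unpair1.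
Qed.

(** * Evaluating a coded polynomial at a coded point *)

(* Every number codes a point with positive coordinates, so the search below
   needs no validity test. *)
Definition code_point z i := (unpair1 (iter i unpair2 z)).+1.

(** The accumulator pairs the partial product with what remains of z; each exponent read consumes
    one coordinate. *)
Definition code_monomial z m :=
  unpair1 (code_fold (fun st e =>
    code_pair (unpair1 st * (unpair1 (unpair2 st)).+1 ^ e)
              (unpair2 (unpair2 st))) (code_pair 1 z) m).

Lemma code_monomialE z s : code_monomial z (code_seq s) =
  \prod_(i < size s) code_point z i ^ nth 0 s i.
Proof.
(* The initial product 1 becomes an arbitrary q, as the induction changes it. *)
rewrite /code_monomial code_foldE -[RHS]mul1n; move: {1 2}1 => q.
elim: s z q => [|a s IHs] z q /=; first by rewrite big_ord0 unpair1K muln1.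
rewrite big_ord_recl mulnA /= !unpair1K !unpair2K IHs.
by congr (_ * _); apply: eq_bigr => i _; rewrite /code_point /= -iterS iterSr.
Qed.

Lemma computable1_monomial f g :
  computable1 f -> computable1 g ->
  computable1 (fun e => code_monomial (f e) (g e)).
Proof.
move=> cf cg; apply: computable1_unpair1.
apply: (computable1_code_fold (fun _ st e =>
    code_pair (unpair1 st * (unpair1 (unpair2 st)).+1 ^ e)
              (unpair2 (unpair2 st)))) => //.
  by apply: computable1_pair => //; apply: computable1_const.
have cst : computable1 (fun q => unpair1 (unpair2 q)).
  by apply: computable1_unpair1; apply: computable1_unpair2 computable1_id.
apply: computable1_pair; last by do 2!apply: computable1_unpair2.
apply: computable1_mul; first exact: computable1_unpair1.
apply: computable1_exp; last first.
  by do 2!apply: computable1_unpair2; apply: computable1_id.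
apply: computable1_succ; apply: computable1_unpair1.
exact: computable1_unpair2.
Qed.

(** Positive and negative parts of the integer with code k. Odd codes are those of [Negz n], which
    is -(n + 1), hence the successor in [neg_coef]. *)
Definition pos_coef k := if odd k then 0 else k./2.
Definition neg_coef k := if odd k then k./2.+1 else 0.

Lemma computable1_pos_coef : computable1 pos_coef.
Proof.
apply: computable1_if; first exact: computable1_odd computable1_id.
  exact: computable1_const.
exact: computable1_half computable1_id.
Qed.

Lemma computable1_neg_coef : computable1 neg_coef.
Proof.
apply: computable1_if; first exact: computable1_odd computable1_id.
  exact: computable1_succ (computable1_half _ computable1_id).
exact: computable1_const.
Qed.

Lemma pos_coef_leq k : pos_coef k <= k.
Proof. by rewrite /pos_coef; case: ifP; lia. Qed.

Lemma neg_coef_leq k : neg_coef k <= k.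
Proof. by rewrite /neg_coef; case: ifP; lia. Qed.

Lemma pos_neg_coef (c : int) :
  c = (Posz (pos_coef (code_int c)) - Posz (neg_coef (code_int c)))%R.
Proof.
rewrite /pos_coef /neg_coef; case: c => n /=; rewrite odd_double /=.
  by rewrite doubleK GRing.subr0.
by rewrite uphalf_double GRing.sub0r NegzE.
Qed.

Definition code_terms (coef : nat -> nat) z c :=
  code_fold (fun a t => a + coef (unpair1 t) * code_monomial z (unpair2 t)) 0 c.

Lemma computable1_terms coef f g : computable1 coef -> computable1 f ->
  computable1 g -> computable1 (fun e => code_terms coef (f e) (g e)).
Proof.
move=> ccoef cf cg.
apply: (computable1_code_fold (fun e a t =>
  a + coef (unpair1 t) * code_monomial (f e) (unpair2 t))) => //.
  exact: computable1_const.
have ct : computable1 (fun q => unpair2 (unpair2 q)).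
  by do 2!apply: computable1_unpair2; apply: computable1_id.
apply: computable1_add.
  by apply: computable1_unpair1; apply: computable1_unpair2 computable1_id.
apply: computable1_mul.
  by apply: computable1_comp ccoef _; apply: computable1_unpair1.
apply: computable1_monomial; last exact: computable1_unpair2.
exact: computable1_comp cf (computable1_unpair1 _ computable1_id).
Qed.

Lemma foldl_addn T (f : T -> nat) a s :
  foldl (fun b t => b + f t) a s = a + \sum_(t <- s) f t.
Proof.
elim: s a => [|t s IHs] a /=; first by rewrite big_nil addn0.
by rewrite big_cons IHs addnA.
Qed.

Definition mpoly_part p (D : {mpoly int[p]}) (coef : nat -> nat)
    (x : 'I_p -> nat) : nat :=
  \sum_(m <- msupp D) coef (code_int D@_m) * \prod_i x i ^ m i.

Lemma code_termsE coef z p (D : {mpoly int[p]}) :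
  code_terms coef z (unpair2 (code_dioph D)) =
  mpoly_part p D coef (fun i => code_point z i).
Proof.
rewrite /code_terms /code_dioph unpair2K code_foldE /mpoly_part.
(* Sorting the monomials only permutes the sum. *)
rewrite -[RHS](perm_big _ (permEl (perm_sort <=%O _))) /= foldl_addn add0n.
rewrite big_map; apply: eq_bigr => m _.
rewrite unpair1K unpair2K code_monomialE size_tuple.
by congr (_ * _); apply: eq_bigr => i _; rewrite (mnm_nth 0).
Qed.

Lemma meval_eq0 p (D : {mpoly int[p]}) (x : 'I_p -> nat) :
  D.@[fun i => Posz (x i)]%R = 0%R <->
  mpoly_part p D pos_coef x = mpoly_part p D neg_coef x.
Proof.
have -> : D.@[fun i => Posz (x i)]%R =
    (Posz (mpoly_part p D pos_coef x) - Posz (mpoly_part p D neg_coef x))%R.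
  rewrite mevalE /mpoly_part !(big_morph Posz PoszD erefl) -GRing.sumrB.
  apply: eq_bigr => m _; rewrite {1}[(D@_m)%R]pos_neg_coef !PoszM -GRing.mulrBl.
  congr (_ * _)%R; rewrite (big_morph Posz PoszM erefl).
  by apply: eq_bigr => i _; rewrite -!natz GRing.natrX.
split=> [/eqP|->]; last by rewrite GRing.subrr.
by rewrite GRing.subr_eq0 => /eqP[].
Qed.

Definition code_test c z :=
  code_terms pos_coef z (unpair2 c) == code_terms neg_coef z (unpair2 c).

Lemma code_testP p (D : {mpoly int[p]}) z :
  code_test (code_dioph D) z <->
  dioph_solutions D [ffun i : 'I_p => code_point z i].
Proof.
rewrite /code_test !code_termsE; split=> [/eqP/meval_eq0 D0|[_ D0]].
  split=> [i|]; first by rewrite ffunE.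
  by rewrite -D0; apply: meval_eq => i; rewrite ffunE.
apply/eqP/meval_eq0; rewrite -D0; apply: meval_eq => i; by rewrite ffunE.
Qed.

(** * Bounded search over coded points *)

Definition code_points_bound p b := iter p (fun z => (b + z + 1) ^ 2) 0.

(** Pairing a coordinate at most b with a code at most z gives a code at most (b + z + 1)^2; the
    bound iterates this once per coordinate. *)
Lemma code_point_surj p b (x : {ffun 'I_p -> nat}) :
  (forall i, 0 < x i) -> (forall i, x i <= b) ->
  exists2 z, z <= code_points_bound p b & x = [ffun i : 'I_p => code_point z i].
Proof.
move=> x_gt0 x_le; pose s := [seq (x i).-1 | i : 'I_p].
have size_s : size s = p by rewrite size_map size_enum_ord.
have le_s a : a \in s -> a <= b.
  by move=> /mapP[i _ ->]; have := x_le i; lia.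
(* Nested pairs ending in 0. The entries of [s] are predecessors because [code_point] adds 1. *)
exists (foldr code_pair 0 s).
  rewrite -[in X in code_points_bound X]size_s.
  elim: s {size_s} le_s => //= a s IHs le_s.
  apply: leq_trans (code_pair_leq_sqr _ _) _; rewrite leq_exp2r //.
  have le_ab : a <= b by apply: le_s; rewrite inE eqxx.
  have : foldr code_pair 0 s <= code_points_bound (size s) b.
    by apply: IHs => c cs; apply: le_s; rewrite inE cs orbT.
  by rewrite /code_points_bound; lia.
apply/ffunP => i; rewrite ffunE.
have decodeK (t : seq nat) j : j < size t ->
    code_point (foldr code_pair 0 t) j = (nth 0 t j).+1.
  elim: t j => [|a t IHt] [|j] //= lt_jt; rewrite /code_point.
    by rewrite /= unpair1K.
  by rewrite iterSr unpair2K; apply: IHt.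
rewrite decodeK ?size_s // (nth_map i) ?size_enum_ord // nth_ord_enum.
by rewrite prednK.
Qed.

Definition search bound c := 0 < \sum_(z < bound c) code_test c z.

Lemma computable1_search bound :
  computable1 bound -> computable1 (fun c => search bound c : nat).
Proof.
move=> cb; apply: computable1_gt0.
apply: (computable1_sum _ (fun c z => code_test c z : nat)) => //.
have cz : computable1 (fun q => unpair1 (unpair2 q)).
  by apply: computable1_unpair1; apply: computable1_unpair2 computable1_id.
have cD : computable1 (fun q => unpair2 (unpair1 q)).
  by apply: computable1_unpair2; apply: computable1_unpair1 computable1_id.
apply: computable1_eq; apply: computable1_terms => //.
  exact: computable1_pos_coef.
exact: computable1_neg_coef.
Qed.

Lemma searchP bound c :
  reflect (exists2 z, z < bound c & code_test c z) (search bound c).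
Proof.
rewrite /search lt0n sum_nat_eq0 negb_forall.
apply: (iffP existsP) => [[z]|[z lt_zb tz]]; last first.
  by exists (Ordinal lt_zb); rewrite /= tz.
by rewrite /= eqb0 negbK; exists z.
Qed.

(** * Systems of equations that determine their auxiliary variables *)

(* [inl (i, j, k)] and [inr (i, k)] stand for the equations of [E n], with
   variables numbered by unbounded indices into a sequence of values. *)
Definition equation : eqType := (nat * nat * nat + nat * nat)%type.

Definition sat (s : seq nat) (e : equation) : bool :=
  match e with
  | inl (i, j, k) => nth 0 s i * nth 0 s j == nth 0 s k
  | inr (i, k) => nth 0 s i + 1 == nth 0 s k
  end.

Definition below n (e : equation) : bool :=
  match e with
  | inl (i, j, k) => [&& i < n, j < n & k < n]
  | inr (i, k) => (i < n) && (k < n)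
  end.

Lemma below_leq m n e : m <= n -> below m e -> below n e.
Proof. by case: e => [[[i j] k]|[i k]] /=; lia. Qed.

Lemma sat_cat s t e : below (size s) e -> sat (s ++ t) e = sat s e.
Proof.
by case: e => [[[i j] k] /and3P[li lj lk]|[i k] /andP[li lk]] /=;
  rewrite !nth_cat ?li ?lj ?lk.
Qed.

Lemma all_sat_cat s t eqs :
  all (below (size s)) eqs -> all (sat (s ++ t)) eqs = all (sat s) eqs.
Proof.
by move=> /allP eqs_s; apply: eq_in_all => e /eqs_s; apply: sat_cat.
Qed.

(* Given positive values [s] of the first [n] variables, the system [eqs]
   holds for exactly one positive choice [h s] of the next [k] variables. *)
Definition determines n k (eqs : seq equation) (h : seq nat -> seq nat) :
    Prop :=
  all (below (n + k)) eqs /\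
  forall s, size s = n -> all (ltn 0) s ->
    [/\ size (h s) = k, all (ltn 0) (h s) &
        forall w, size w = k -> all (ltn 0) w ->
          (all (sat (s ++ w)) eqs <-> w = h s)].

Lemma determines0 n : determines n 0 [::] (fun=> [::]).
Proof. by split=> // s _ _; split=> // w /size0nil ->. Qed.

(** As [eqs1] involves only the first n + k variables, it forces the first k entries of w; [eqs2]
    then forces the other l, with those k among its given values. *)
Lemma determines_cat n k l eqs1 eqs2 h1 h2 :
  determines n k eqs1 h1 -> determines (n + k) l eqs2 h2 ->
  determines n (k + l) (eqs1 ++ eqs2) (fun s => h1 s ++ h2 (s ++ h1 s)).
Proof.
move=> [b1 d1] [b2 d2]; split.
  rewrite addnA all_cat b2 andbT.
  by apply: sub_all b1 => e; apply: below_leq; rewrite leq_addr.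
move=> s size_s s_gt0; have [size_h1 h1_gt0 h1P] := d1 s size_s s_gt0.
have size_s1 : size (s ++ h1 s) = n + k by rewrite size_cat size_s size_h1.
have s1_gt0 : all (ltn 0) (s ++ h1 s) by rewrite all_cat s_gt0.
have [size_h2 h2_gt0 h2P] := d2 _ size_s1 s1_gt0.
split=> [||w size_w w_gt0]; first by rewrite size_cat size_h1 size_h2.
  by rewrite all_cat h1_gt0.
have size_tk : size (take k w) = k by rewrite size_takel // size_w leq_addr.
have size_dr : size (drop k w) = l by rewrite size_drop size_w addKn.
have [tk_gt0 dr_gt0] : all (ltn 0) (take k w) /\ all (ltn 0) (drop k w).
  by apply/andP; rewrite -all_cat cat_take_drop.
have all1 : all (sat (s ++ w)) eqs1 = all (sat (s ++ take k w)) eqs1.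
  rewrite -[w in LHS](cat_take_drop k) catA all_sat_cat //.
  by rewrite size_cat size_s size_tk.
rewrite all_cat all1; split=> [/andP[/(h1P _ size_tk tk_gt0) tkE]|->].
  rewrite -(cat_take_drop k w) tkE catA.
  by move=> /(h2P _ size_dr dr_gt0) ->.
rewrite take_size_cat //; apply/andP; split; first exact/h1P.
by rewrite catA; apply/h2P.
Qed.

(** The only positive a with a * a = a is 1. *)
Lemma determines_one n : determines n 1 [:: inl (n, n, n)] (fun=> [:: 1]).
Proof.
split=> [|s size_s _]; first by rewrite /= addn1 ltnSn.
split=> // -[|a []] //= _; rewrite nth_cat size_s ltnn subnn !andbT /=.
move=> a_gt0; split=> [/eqP|[->] //].
by move=> aa; congr [:: _]; nia.
Qed.

(** The index r locates the result among the variables. Allowing every n lets a gadget be placed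
    after any variables already introduced. *)
Definition gadget (op : nat -> nat -> nat) k : Prop :=
  forall n i j, i < n -> j < n -> exists eqs h r,
    [/\ determines n k eqs h, r < n + k &
        forall s, size s = n ->
          nth 0 (s ++ h s) r = op (nth 0 s i) (nth 0 s j)].

Lemma nth_gt0 s i : all (ltn 0) s -> i < size s -> 0 < nth 0 s i.
Proof. by move=> /all_nthP; apply. Qed.

Lemma gadget_mul : gadget muln 1.
Proof.
move=> n i j lt_in lt_jn.
exists [:: inl (i, j, n)], (fun s => [:: nth 0 s i * nth 0 s j]), n.
split=> [||s size_s]; first split=> [|s size_s s_gt0].
- by rewrite /=; lia.
- have x_gt0 : 0 < nth 0 s i by rewrite nth_gt0 ?size_s.
  have y_gt0 : 0 < nth 0 s j by rewrite nth_gt0 ?size_s.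
  split=> [//||]; first by rewrite /= muln_gt0 x_gt0 y_gt0.
  move=> [|a []] //= _ _; rewrite !nth_cat size_s lt_in lt_jn ltnn subnn !andbT.
  by split=> [/eqP ->|[->]].
- by rewrite addn1.
- by rewrite nth_cat size_s ltnn subnn.
Qed.

(* Julia Robinson: for z > 0, (x z + 1) (y z + 1) = z^2 (x y + 1) + 1 amounts
   to z (x + y) = z^2, that is, to x + y = z. *)
Lemma gadget_add : gadget addn 10.
Proof.
move=> n i j lt_in lt_jn.
pose h s := let x := nth 0 s i in let y := nth 0 s j in let z := x + y in
  [:: z; x * z; x * z + 1; y * z; y * z + 1; z * z; x * y; x * y + 1;
      z * z * (x * y + 1); z * z * (x * y + 1) + 1].
(* Variable n + 0 is the candidate sum z. The next nine equations define the other new variables as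
   subterms in x, y and z, and the last one is the identity that forces z = x + y. *)
pose eqs : seq equation :=
  [:: inl (i, n + 0, n + 1); inr (n + 1, n + 2); inl (j, n + 0, n + 3);
      inr (n + 3, n + 4); inl (n + 0, n + 0, n + 5); inl (i, j, n + 6);
      inr (n + 6, n + 7); inl (n + 5, n + 7, n + 8); inr (n + 8, n + 9);
      inl (n + 2, n + 4, n + 9)].
exists eqs, h, n; split=> [||s size_s]; first split=> [|s size_s s_gt0].
- by rewrite /= !ltn_add2l !ltn_addr.
- have x_gt0 : 0 < nth 0 s i by rewrite nth_gt0 ?size_s.
  have y_gt0 : 0 < nth 0 s j by rewrite nth_gt0 ?size_s.
  split=> [//||w size_w w_gt0].
    rewrite /h; move: (nth 0 s i) (nth 0 s j) x_gt0 y_gt0 => x y x_gt0 y_gt0.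
    by rewrite /= !addn1 !(muln_gt0, addn_gt0) /= x_gt0 y_gt0.
  have nthL m : m < n -> nth 0 (s ++ w) m = nth 0 s m.
    by move=> lt_mn; rewrite nth_cat size_s lt_mn.
  have nthR m : nth 0 (s ++ w) (n + m) = nth 0 w m.
    by rewrite nth_cat size_s -ltn_subRL subnn addKn.
  rewrite /= !(nthL _ lt_in) !(nthL _ lt_jn) !nthR /h.
  move: (nth 0 s i) (nth 0 s j) x_gt0 y_gt0 => x y x_gt0 y_gt0.
  case: w size_w w_gt0 {nthL nthR} => [|z [|w1 [|w2 [|w3 [|w4 [|w5 [|w6
    [|w7 [|w8 [|w9 []]]]]]]]]]] //= _ /andP[z_gt0 _].
  split=> [|[-> -> -> -> -> -> -> -> -> ->]]; last first.
    by rewrite !eqxx /= andbT; apply/eqP; nia.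
  do 9!(case/andP=> /eqP <-); rewrite andbT => /eqP eq_xyz.
  by have -> : z = x + y by nia.
- by rewrite -[ltnLHS]addn0 ltn_add2l.
- by rewrite nth_cat size_s ltnn subnn.
Qed.

(** * Polynomial expressions as determined variables, with a count of the variables *)

Section Definable.

Variable p : nat.
Implicit Types (f g : {ffun 'I_p -> nat} -> nat).

Definition definable k f : Prop :=
  forall n, p <= n -> exists eqs h r,
    [/\ determines n k eqs h, r < n + k &
        forall s, size s = n -> all (ltn 0) s ->
          nth 0 (s ++ h s) r = f [ffun i : 'I_p => nth 0 s i]].

Lemma eq_definable k f g : f =1 g -> definable k f -> definable k g.
Proof.
move=> fg df n le_pn; have [eqs [h [r [d lt_r hr]]]] := df n le_pn.
by exists eqs, h, r; split=> // s size_s s_gt0; rewrite -fg hr.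
Qed.

(** Padding variables are forced to equal 1, so the auxiliary values remain unique. *)
Lemma definable_weaken k l f : k <= l -> definable k f -> definable l f.
Proof.
move=> /subnKC <- df; elim: (l - k) => [|m IHm] n le_pn.
  by rewrite addn0; apply: df.
have [eqs [h [r [d lt_r hr]]]] := IHm n le_pn.
rewrite addnS -addn1.
exists (eqs ++ [:: inl (n + (k + m), n + (k + m), n + (k + m))]),
  (fun s => h s ++ [:: 1]), r.
split; first exact: determines_cat d (determines_one _).
  by rewrite addnA ltn_addr.
move=> s size_s s_gt0; have [size_h _ _] := d.2 s size_s s_gt0.
by rewrite catA nth_cat size_cat size_s size_h lt_r hr.
Qed.

Lemma definable_var (i : 'I_p) : definable 0 (fun x => x i).
Proof.
move=> n le_pn; exists [::], (fun=> [::]), i.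
split; first exact: determines0.
  by rewrite addn0 (leq_trans _ le_pn).
by move=> s size_s _; rewrite cats0 ffunE.
Qed.

Lemma definable_one : definable 1 (fun=> 1).
Proof.
move=> n le_pn; exists [:: inl (n, n, n)], (fun=> [:: 1]), n.
split; [exact: determines_one | by rewrite addn1 |].
by move=> s size_s _; rewrite nth_cat size_s ltnn subnn.
Qed.

Lemma definable_gadget op m k l f g : gadget op m ->
  definable k f -> definable l g ->
  definable (k + l + m) (fun x => op (f x) (g x)).
Proof.
move=> gop df dg n le_pn.
have [eqs1 [h1 [r1 [d1 lt_r1 hr1]]]] := df n le_pn.
have [eqs2 [h2 [r2 [d2 lt_r2 hr2]]]] :=
  dg (n + k) (leq_trans le_pn (leq_addr _ _)).
have lt_r1l : r1 < n + k + l by rewrite ltn_addr.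
have [eqs3 [h3 [r3 [d3 lt_r3 hr3]]]] := gop (n + k + l) r1 r2 lt_r1l lt_r2.
have d12 := determines_cat _ _ _ _ _ _ _ d1 d2; rewrite -addnA in d3 lt_r3 hr3.
have d := determines_cat _ _ _ _ _ _ _ d12 d3.
exists (eqs1 ++ eqs2 ++ eqs3); eexists; exists r3; split.
- by rewrite catA; exact: d.
- by rewrite addnA.
move=> s size_s s_gt0; have [size_h1 h1_gt0 _] := d1.2 s size_s s_gt0.
have size_s1 : size (s ++ h1 s) = n + k by rewrite size_cat size_s size_h1.
have s1_gt0 : all (ltn 0) (s ++ h1 s) by rewrite all_cat s_gt0.
have [size_h2 _ _] := d2.2 _ size_s1 s1_gt0.
rewrite /= catA hr3; last by rewrite !size_cat size_s size_h1 size_h2 addnA.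
rewrite !catA hr2 // nth_cat size_s1 lt_r1 hr1 //; congr (op (f _) (g _)).
(* [g] reads the point from the first p entries, which appending [h1 s] leaves unchanged. *)
by apply/ffunP => i; rewrite !ffunE nth_cat size_s (leq_trans (ltn_ord i)).
Qed.

(** Each increment adds a fresh 1: one variable for this 1 and ten for the addition. *)
Lemma definable_const c : definable (11 * c).+1 (fun=> c.+1).
Proof.
elim: c => [|c IHc]; first exact: definable_one.
apply: (@definable_weaken ((11 * c).+1 + 1 + 10)); first by lia.
apply: (@eq_definable _ (fun=> c.+1 + 1)) => [x|]; first by rewrite addn1.
exact: definable_gadget gadget_add IHc definable_one.
Qed.

(** One variable for the empty product, then one multiplication per unit of degree. *)
Lemma definable_monomial (m : 'I_p -> nat) :
  definable (\sum_i m i).+1 (fun x => \prod_i x i ^ m i).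
Proof.
elim: (index_enum _) => [|i r IHr].
  rewrite big_nil; apply: eq_definable definable_one => x.
  by rewrite big_nil.
rewrite big_cons; apply: (@eq_definable _
    (fun x => x i ^ m i * \prod_(j <- r) x j ^ m j)) => [x|].
  by rewrite big_cons.
elim: (m i) => [|e IHe].
  by apply: eq_definable IHr => x; rewrite mul1n.
apply: (@eq_definable _ (fun x =>
    x i * (x i ^ e * \prod_(j <- r) x j ^ m j))) => [x|].
  by rewrite mulnA expnS.
apply: definable_weaken (definable_gadget _ _ _ _ _ _ gadget_mul
  (definable_var i) IHe); by rewrite add0n addn1 addSn.
Qed.

(** The successor keeps the value positive even for an empty sum. Terms with coefficient 0 are
    skipped; a term with coefficient b + 1 and degree d costs 11 b + 1 for the constant, d + 1 for
    the monomial, 1 for the product and 10 for the addition, at most 11 (b + 1 + d + 1) in total. *)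
Lemma definable_sum (r : seq 'X_{1..p}) (c : 'X_{1..p} -> nat) :
  definable (\sum_(m <- r) 11 * (c m + \sum_i m i + 1)).+1
    (fun x => (\sum_(m <- r) c m * \prod_i x i ^ m i).+1).
Proof.
elim: r => [|m r IHr].
  rewrite big_nil; apply: eq_definable definable_one => x.
  by rewrite big_nil.
rewrite big_cons; apply: (@eq_definable _ (fun x =>
    c m * (\prod_i x i ^ m i) + (\sum_(j <- r) c j * \prod_i x i ^ j i).+1)).
  by move=> x; rewrite big_cons addnS.
case: (c m) => [|b].
  by apply: definable_weaken IHr; rewrite ltnS leq_addl.
apply: definable_weaken (definable_gadget _ _ _ _ _ _ gadget_add
  (definable_gadget _ _ _ _ _ _ gadget_mul (definable_const b)
    (definable_monomial m)) IHr).
set A := \sum_i m i; set B := \sum_(j <- r) _; by lia.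
Qed.

End Definable.

(** * Subsets of $E_n$ and the transfer of bounds *)

Definition values n (x : {ffun 'I_n -> nat}) : seq nat := [seq x i | i : 'I_n].

Lemma size_values n x : size (values n x) = n.
Proof. by rewrite size_map size_enum_ord. Qed.

Lemma nth_values n x (i : 'I_n) : nth 0 (values n x) i = x i.
Proof. by rewrite (nth_map i) ?size_enum_ord // nth_ord_enum. Qed.

Lemma values_ffun n s : size s = n -> values n [ffun i : 'I_n => nth 0 s i] = s.
Proof.
move=> size_s; apply: (@eq_from_nth _ 0) => [|i]; rewrite size_values //.
by move=> lt_in; rewrite (nth_values _ _ (Ordinal lt_in)) ffunE.
Qed.

Lemma values_gt0 n x : all (ltn 0) (values n x) <-> forall i, 0 < x i.
Proof.
split=> [/(all_nthP 0) x_gt0 i|x_gt0].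
  by have := x_gt0 i; rewrite nth_values size_values; apply.
by apply/allP => _ /mapP[i _ ->]; apply: x_gt0.
Qed.

Definition equation_of n (e : E n) : equation :=
  match e with
  | inl (i, j, k) => inl (val i, val j, val k)
  | inr (i, k) => inr (val i, val k)
  end.

Lemma satisfiesP n (x : {ffun 'I_n -> nat}) (e : E n) :
  satisfies x e <-> sat (values n x) (equation_of n e).
Proof.
by case: e => [[[i j] k]|[i k]] /=; rewrite !nth_values; split=> /eqP.
Qed.

Lemma equation_of_surj n e : below n e -> exists e', equation_of n e' = e.
Proof.
case: e => [[[i j] k] /and3P[li lj lk]|[i k] /andP[li lk]].
  by exists (inl (Ordinal li, Ordinal lj, Ordinal lk)).
by exists (inr (Ordinal li, Ordinal lk)).
Qed.

Definition system n (eqs : seq equation) : {set E n} :=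
  [set e | equation_of n e \in eqs].

Lemma solutions_system n eqs x : all (below n) eqs ->
  solutions (system n eqs) x <->
  all (ltn 0) (values n x) /\ all (sat (values n x)) eqs.
Proof.
move=> /allP eqs_n; split=> [[x_gt0 xS]|[/values_gt0 x_gt0 /allP xS]].
  split; first exact/values_gt0.
  apply/allP => e eqs_e; have [e' e'E] := equation_of_surj n e (eqs_n e eqs_e).
  by rewrite -e'E; apply/satisfiesP/xS; rewrite inE e'E.
by split=> // e; rewrite inE => /xS /satisfiesP.
Qed.

(** Solutions of the system are the points of [Q] extended by their determined values, so they are
    finite in number, and a solution bounded by b restricts to a point of [Q] bounded by b. Besides
    k + l variables for f and g, one is spent on testing f x = g x. *)
Lemma bounded_equation p k l f g b (Q : set {ffun 'I_p -> nat}) :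
  definable p k f -> definable p l g -> bounds_systems (p + (k + l + 1)) b ->
  (forall x, Q x <-> (forall i, 0 < x i) /\ f x = g x) ->
  finite_set Q -> (exists x, Q x) -> exists x, Q x /\ forall i, x i <= b.
Proof.
move=> df dg bounds QP Qfin [x0 Qx0].
have [eqs1 [h1 [r1 [d1 lt_r1 hr1]]]] := df p (leqnn p).
have [eqs2 [h2 [r2 [d2 lt_r2 hr2]]]] := dg (p + k) (leq_addr _ _).
have lt_r1l : r1 < p + k + l by rewrite ltn_addr.
have [eqs3 [h3 [r3 [d3 lt_r3 hr3]]]] := gadget_mul _ _ _ lt_r1l lt_r1l.
have d12 := determines_cat _ _ _ _ _ _ _ d1 d2; rewrite -addnA in d3 lt_r3 hr3.
pose eqs := (eqs1 ++ eqs2) ++ eqs3.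
pose h s := let t := h1 s ++ h2 (s ++ h1 s) in t ++ h3 (s ++ t).
have [eqs_N d] : determines p (k + l + 1) eqs h by apply: determines_cat d12 d3.
set N := p + (k + l + 1) in bounds eqs_N *.
pose S := system N (inl (r1, r2, r3) :: eqs).
have S_N : all (below N) (inl (r1, r2, r3) :: eqs).
  by rewrite /= eqs_N andbT /N; lia.
(* The variable r3 holds the square of r1, so that r1 * r2 = r3 forces the
   equality of the values f x and g x held by r1 and r2. *)
have satE s : size s = p -> all (ltn 0) s ->
    sat (s ++ h s) (inl (r1, r2, r3)) <->
    f [ffun i : 'I_p => nth 0 s i] = g [ffun i : 'I_p => nth 0 s i].
  move=> size_s s_gt0; have [size_h1 h1_gt0 _] := d1.2 s size_s s_gt0.
  have size_s1 : size (s ++ h1 s) = p + k by rewrite size_cat size_s size_h1.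
  have s1_gt0 : all (ltn 0) (s ++ h1 s) by rewrite all_cat s_gt0.
  have [size_h2 _ _] := d2.2 _ size_s1 s1_gt0.
  have size_s2 : size (s ++ h1 s ++ h2 (s ++ h1 s)) = p + (k + l).
    by rewrite !size_cat size_s size_h1 size_h2.
  have nth1 t : nth 0 ((s ++ h1 s) ++ t) r1 = f [ffun i : 'I_p => nth 0 s i].
    by rewrite nth_cat size_s1 lt_r1 hr1.
  have f_gt0 : 0 < f [ffun i : 'I_p => nth 0 s i].
    by rewrite -(nth1 [::]) cats0 nth_gt0 // size_s1.
  have nth2 t : nth 0 ((s ++ h1 s ++ h2 (s ++ h1 s)) ++ t) r2 =
      g [ffun i : 'I_p => nth 0 s i].
    rewrite nth_cat size_s2 addnA lt_r2 catA hr2 //; congr g.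
    by apply/ffunP => i; rewrite !ffunE nth_cat size_s ltn_ord.
  have nth3 : nth 0 (s ++ h s) r3 = f [ffun i : 'I_p => nth 0 s i] ^ 2.
    by rewrite /h catA hr3 // catA nth1.
  have hE : s ++ h s = (s ++ h1 s) ++ h2 (s ++ h1 s) ++
      h3 (s ++ h1 s ++ h2 (s ++ h1 s)) by rewrite /h !catA.
  rewrite /sat nth3 {1}hE nth1 /h catA nth2 -mulnn eqn_pmul2l //.
  by rewrite eq_sym; split=> /eqP.
have solE y : solutions S y <->
    exists2 x, Q x & values N y = values p x ++ h (values p x).
  rewrite (solutions_system _ _ y S_N).
  set v := values N y; have size_v : size v = N by rewrite size_values.
  have size_tk : size (take p v) = p by rewrite size_takel // size_v leq_addr.
  have size_dr : size (drop p v) = k + l + 1 by rewrite size_drop size_v addKn.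
  split=> [[v_gt0 /andP[r_v eqs_v]]|[x /QP[x_gt0 fg] vE]].
    have [tk_gt0 dr_gt0] : all (ltn 0) (take p v) /\ all (ltn 0) (drop p v).
      by apply/andP; rewrite -all_cat cat_take_drop.
    have [_ _ dP] := d _ size_tk tk_gt0.
    have drE : drop p v = h (take p v) by apply/dP; rewrite ?cat_take_drop.
    exists [ffun i : 'I_p => nth 0 (take p v) i]; last first.
      by rewrite values_ffun // -drE cat_take_drop.
    apply/QP; split=> [i|]; first by rewrite ffunE nth_gt0 // size_tk.
    by apply/satE => //; rewrite -drE cat_take_drop.
  have vx_gt0 : all (ltn 0) (values p x) by apply/values_gt0.
  have [size_h h_gt0 dP] := d _ (size_values p x) vx_gt0.
  rewrite vE all_cat vx_gt0; split=> //; apply/andP; split; last exact/dP.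
  apply/satE => //; first exact: size_values.
  suff -> : [ffun i : 'I_p => nth 0 (values p x) i] = x by [].
  by apply/ffunP => i; rewrite ffunE nth_values.
(* The image of [Q] under this extension map contains all solutions of [S], hence finiteness. *)
pose F (x : {ffun 'I_p -> nat}) : {ffun 'I_N -> nat} :=
  [ffun i : 'I_N => nth 0 (values p x ++ h (values p x)) i].
have [||y [/solE[x Qx vE] y_le]] := bounds S.
- exists (F x0); apply/solE; exists x0; rewrite // values_ffun // size_cat.
  have x0_gt0 := (values_gt0 p x0).2 ((QP x0).1 Qx0).1.
  have [size_h _ _] := d _ (size_values p x0) x0_gt0.
  by rewrite size_h size_values.
- apply: sub_finite_set (finite_image F Qfin) => y /solE[x Qx vE].
  exists x => //.
  by apply/ffunP => i; rewrite ffunE -vE nth_values.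
exists x; split=> // i; have lt_iN : i < N by rewrite ltn_addr.
have := y_le (Ordinal lt_iN); rewrite -nth_values vE nth_cat size_values /=.
by rewrite ltn_ord nth_values.
Qed.

Lemma theta_bounds n : bounds_systems n (theta n).
Proof. by rewrite /theta; case: ex_minnP => b /asboolP[]. Qed.

(** A pair code dominates the sum of its components, and a sequence code the sum of the successors
    of its entries; the latter accounts for the + 1 of each term. *)
Lemma code_dioph_geq p (D : {mpoly int[p]}) (coef : nat -> nat) :
  (forall k, coef k <= k) ->
  p + \sum_(m <- msupp D) (coef (code_int (D@_m)%R) + \sum_i m i + 1) <=
  code_dioph D.
Proof.
move=> le_coef; apply: leq_trans (leq_add_code_pair _ _); rewrite leq_add2l.
apply: leq_trans (leq_sum_code_seq _); rewrite big_map.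
rewrite -[leqLHS](perm_big _ (permEl (perm_sort <=%O _))) /=.
apply: leq_sum => m _; rewrite addn1 ltnS.
apply: leq_trans (leq_add_code_pair _ _); apply: leq_add => //.
apply: leq_trans (leq_sum_code_seq _).
rewrite [leqRHS](big_nth 0) big_mkord size_tuple; apply: leq_sum => i _.
by rewrite (mnm_nth 0).
Qed.

(** With A and B the costs of D+ and D- and c the code, p + A <= c and p + B <= c, so the p + (11 A
    + 1) + (11 B + 1) + 1 variables number at most 22 c + 3. *)
Lemma bounded_dioph_solution p (D : {mpoly int[p]}) n b :
  22 * code_dioph D + 3 <= n -> bounds_systems n b ->
  finite_set (dioph_solutions D) -> (exists x, dioph_solutions D x) ->
  exists x, dioph_solutions D x /\ forall i, x i <= b.
Proof.
move=> le_n bounds.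
have dpos := definable_sum p (msupp D) (fun m => pos_coef (code_int (D@_m)%R)).
have dneg := definable_sum p (msupp D) (fun m => neg_coef (code_int (D@_m)%R)).
have := code_dioph_geq p D _ pos_coef_leq.
have := code_dioph_geq p D _ neg_coef_leq.
rewrite -big_distrr /= in dpos; rewrite -big_distrr /= in dneg.
move: dpos dneg; set A := (\sum_(m <- _) (pos_coef _ + _ + 1)).
set B := (\sum_(m <- _) (neg_coef _ + _ + 1)) => dpos dneg le_B le_A.
(* The block for D+ is padded so that the system has exactly n variables. *)
have nE : n = p + (n - p - (11 * B).+1 - 1 + (11 * B).+1 + 1) by lia.
rewrite nE in bounds.
have le_k : (11 * A).+1 <= n - p - (11 * B).+1 - 1 by lia.
apply: (bounded_equation _ _ _ _ _ _ _ (definable_weaken _ _ _ _ le_k dpos)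
  dneg bounds) => x.
split=> -[x_gt0 Dx]; split=> //; first by congr _.+1; apply/meval_eq0.
by apply/meval_eq0; case: Dx.
Qed.

(** * The search bound and the algorithm *)

Definition theta_bound n := (2 ^ (2 ^ (n - 5)) - 1) ^ (2 ^ (n - 5)) + 1.

(** [unpair1 c] is the number of unknowns; the successor is there because [search] stays strictly
    below its bound. *)
Definition search_bound delta c :=
  (code_points_bound (unpair1 c) (theta_bound (22 * c + 3 + delta))).+1.

Lemma computable1_search_bound delta : computable1 (search_bound delta).
Proof.
have cn : computable1 (fun c => 22 * c + 3 + delta).
  apply: computable1_add; last exact: computable1_const.
  apply: computable1_add; last exact: computable1_const.
  exact: computable1_mul (computable1_const 22) computable1_id.
have cb : computable1 (fun c => theta_bound (22 * c + 3 + delta)).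
  have c2n : computable1 (fun c => 2 ^ (22 * c + 3 + delta - 5)).
    apply: computable1_exp; first exact: computable1_const.
    by apply: computable1_sub => //; apply: computable1_const.
  apply: computable1_add; last exact: computable1_const.
  apply: computable1_exp => //.
  apply: computable1_sub; last exact: computable1_const.
  by apply: computable1_exp => //; apply: computable1_const.
apply: computable1_succ.
apply: (computable1_iter _
  (fun c z => (theta_bound (22 * c + 3 + delta) + z + 1) ^ 2)).
- exact: computable1_unpair1 computable1_id.
- exact: computable1_const.
apply: computable1_exp; last exact: computable1_const.
apply: computable1_add; last exact: computable1_const.
apply: computable1_add; last first.
  by do 2!apply: computable1_unpair2; apply: computable1_id.
exact: computable1_comp cb (computable1_unpair1 _ computable1_id).
Qed.

(* The output 1 (true) stands for "Yes" and the output 0 (false) for "No" *)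
Theorem theorem4 :
  (exists delta : nat, 9 <= delta /\
     forall n : nat, delta <= n ->
       theta n <= (2 ^ (2 ^ (n - 5)) - 1) ^ (2 ^ (n - 5)) + 1) ->
  exists A : murec 1,
    forall (p : nat) (D : {mpoly int[p]}),
      exists answer : bool,
        mueval A [tuple code_dioph D] answer /\
        (finite_set (dioph_solutions D) ->
           (answer = true <-> exists x, dioph_solutions D x)).
Proof.
move=> [delta [_ theta_le]].
have [A AP] := computable1_search _ (computable1_search_bound delta).
exists A => p D; exists (search (search_bound delta) (code_dioph D)).
split=> [|Dfin]; first exact: (AP [tuple code_dioph D]).
split=> [/searchP[z _ /code_testP Dz]|exD]; first by eexists; exact: Dz.
(* The summand [delta] makes n at least [delta], so the assumed bound on [theta n] applies. *)
pose n := 22 * code_dioph D + 3 + delta.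
have [x [Dx x_le]] := bounded_dioph_solution _ D n _ (leq_addr _ _)
  (theta_bounds n) Dfin exD.
have [z z_le xE] := code_point_surj p (theta_bound n) x Dx.1
  (fun i => leq_trans (x_le i) (theta_le n (leq_addl _ _))).
apply/searchP; exists z.
  by rewrite /search_bound ltnS {1}/code_dioph unpair1K.
by apply/code_testP; rewrite -xE.
Qed.
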